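(* Let $K\subset\mathbb{C}$ be an unshielded compactum. Then the core decomposition $\mathcal{D}_K^{PC}$ of $K$ with respect to the property of being a Peano compactum coincides with the core decomposition $\mathcal{D}_K^{FS}$ of $K$ with respect to the property of being finitely Suslinian.
   Context: A compactum is a compact metric space; a continuum is a connected compactum; a Peano continuum is a locally connected continuum. A Peano compactum is a compact metric space all of whose components are Peano continua and such that for every $C>0$ all but finitely many of its components have diameter less than $C$. A compactum is finitely Suslinian if every collection of pairwise disjoint subcontinua whose diameters are bounded away from zero is finite. A compactum $K\subset\mathbb{C}$ is unshielded if $K=\partial W$, where $W$ is the unbounded component of $\mathbb{C}\setminus K$. An upper semi-continuous decomposition $\mathcal{D}$ of a compactum $K$ is a partition of $K$ such that for every open set $B\subset K$ the union of all $d\in\mathcal{D}$ with $d\subset B$ is open in $K$; it carries the quotient topology from the natural projection $\pi:K\to\mathcal{D}$. It is a monotone decomposition if each of its elements is a subcontinuum of $K$; then the quotient is a compact metrizable space, regarded as a compactum with a compatible metric. A monotone decomposition is said to have a topological property $(T)$ if its quotient space has $(T)$. If $\mathcal{D},\mathcal{D}'$ are monotone decompositions of $K$ with property $(T)$ and with projections $\pi,\pi'$, then $\mathcal{D}$ is finer than $\mathcal{D}'$ if there is a map $g:\mathcal{D}\to\mathcal{D}'$ with $\pi'=g\circ\pi$. The core decomposition of $K$ with respect to $(T)$ is the (unique, if existing) monotone decomposition of $K$ with property $(T)$ that is finer than every other monotone decomposition of $K$ with property $(T)$. The core decomposition $\mathcal{D}_K^{PC}$ exists for every compactum $K\subset\mathbb{C}$,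 and the core decomposition $\mathcal{D}_K^{FS}$ exists for every unshielded compactum $K\subset\mathbb{C}$ (a theorem of Blokh, Curry and Oversteegen). *)

(* Defs.v *)
From HB Require Import structures.
From mathcomp Require Import all_boot all_order all_algebra.
From mathcomp Require Import all_classical all_reals all_analysis.
From mathcomp Require Import complex.

Set Implicit Arguments.
Unset Strict Implicit.
Unset Printing Implicit Defensive.

Import Order.TTheory GRing.Theory Num.Theory.
Import numFieldNormedType.Exports.

Local Open Scope classical_set_scope.
Local Open Scope ring_scope.
Local Open Scope complex_scope.
Local Open Scope quotient_scope.

Section topological_notions.
Variable X : topologicalType.

(* [compact] does not entail Hausdorff; the spaces considered here are
   metrizable. *)
Definition subcontinuum (A : set X) : Prop :=
  [/\ A !=set0, compact A & connected A].

Definition locally_connected : Prop :=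
  forall (x : X) (U : set X), open U -> U x ->
    exists V : set X, [/\ open V, V x, connected V & V `<=` U].

Definition components : set (set X) := range (connected_component [set: X]).

End topological_notions.
Arguments locally_connected X : clear implicits.
Arguments components X : clear implicits.

(* Local connectedness is that of A with the topology induced by X. *)
Definition peano_continuum (X : topologicalType) (A : set X) : Prop :=
  subcontinuum A /\ locally_connected (set_type A).

Section metric_notions.
Variables (R : realType) (M : metricType R).

(* Only used for subsets of compact spaces, where the supremum is over a
   bounded set; diam set0 = 0. *)
Definition diam (A : set M) : R := sup [set mdist x y | x in A & y in A].

Definition peano_compactum : Prop :=
  [/\ compact [set: M],
      forall A, components M A -> peano_continuum A &
      forall C : R, 0 < C ->
        finite_set [set A | components M A /\ ~ (diam A < C)]].

Definition finitely_suslinian : Prop :=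
  compact [set: M] /\
  forall F : set (set M),
    (forall A, F A -> subcontinuum A) ->
    trivIset F id ->
    (exists2 C : R, 0 < C & forall A, F A -> C <= diam A) ->
    finite_set F.

End metric_notions.

Definition homeomorphic (X Y : topologicalType) : Prop :=
  exists (f : X -> Y) (g : Y -> X),
    [/\ continuous f, continuous g, cancel f g & cancel g f].

Record decomposition (X : Type) := Decomposition {
  blocks : set (set X);
  blocksP : partition blocks id [set: X] }.

Section quotient_space.
Variables (X : topologicalType) (D : decomposition X).

Lemma ex_block (x : X) : exists d : set_type (blocks D), set_val d x.
Proof.
case: (blocksP D) => + _ _ => /seteqP[_ /(_ x I)] [d Dd dx].
by exists (SigSub (mem_set Dd)).
Qed.

Lemma ex_repr (d : set_type (blocks D)) : exists x : X, set_val d x.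
Proof. by case: (blocksP D) => _ _; apply; exact: set_valP. Qed.

(* The points of the quotient space are the elements of D. *)
Definition quotient_space : Type := set_type (blocks D).

(* The natural projection: block_proj x is the element of D containing x. *)
Definition block_proj (x : X) : quotient_space := sval (cid (ex_block x)).

Definition block_repr (d : quotient_space) : X := sval (cid (ex_repr d)).

Lemma block_reprK : cancel block_repr block_proj.
Proof.
move=> d; rewrite /block_proj /block_repr.
case: cid => x /= dx; case: cid => e /= ex.
apply: val_inj; case: (blocksP D) => _ + _; apply; rewrite ?set_valP //.
- exact: (set_valP e).
- exact: (set_valP d).
- by exists x.
Qed.

HB.instance Definition _ :=
  @isQuotient.Build X quotient_space block_repr block_proj block_reprK.
HB.instance Definition _ :=
  Topological.copy quotient_space (quotient_topology quotient_space).

Lemma quotient_piE : \pi_quotient_space = block_proj.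
Proof. by rewrite unlock. Qed.

Lemma mem_pi (x : X) : set_val (\pi_quotient_space x) x.
Proof. by rewrite quotient_piE /block_proj; case: cid. Qed.

Lemma quotient_openE (U : set quotient_space) :
  open U = open (block_proj @^-1` U).
Proof. by rewrite -quotient_piE. Qed.

Definition upper_semicontinuous : Prop :=
  forall B : set X, open B -> open (\bigcup_(d in [set d | blocks D d /\ d `<=` B]) d).

Definition monotone_decomposition : Prop :=
  upper_semicontinuous /\ forall d, blocks D d -> subcontinuum d.

(* The quotient, regarded as a metric space through a compatible metric, has
   property T. *)
Definition quotient_has (R : realType) (T : metricType R -> Prop) : Prop :=
  exists M : metricType R, homeomorphic quotient_space M /\ T M.

End quotient_space.

(* Such a g is automatically continuous, by [quotient_continuous]. *)
Definition finer (X : topologicalType) (D D' : decomposition X) : Prop :=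
  exists g : quotient_space D -> quotient_space D',
    \pi_(quotient_space D') = g \o \pi_(quotient_space D).

Definition core_decomposition (R : realType) (X : topologicalType)
    (T : metricType R -> Prop) (D : decomposition X) : Prop :=
  [/\ monotone_decomposition D, quotient_has D T &
      forall D' : decomposition X,
        monotone_decomposition D' -> quotient_has D' T -> finer D D'].

(* R[i]^o is the complex plane over R with the topology of the modulus. *)
Definition unshielded (R : realType) (K : set R[i]^o) : Prop :=
  exists W : set R[i]^o,
    [/\ exists2 z, (~` K) z & W = connected_component (~` K) z,
        ~ bounded_set W &
        K = closure W `\` interior W].

(* Main.v *)
Require Import Defs.
From mathcomp Require Import all_boot all_order all_algebra.
From mathcomp Require Import all_classical all_reals all_analysis.
From mathcomp Require Import complex.
From mathcomp Require Import ring lra.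

Set Implicit Arguments.
Unset Strict Implicit.
Unset Printing Implicit Defensive.

Import Order.TTheory GRing.Theory Num.Theory.
Import numFieldNormedType.Exports.

Local Open Scope classical_set_scope.
Local Open Scope ring_scope.
Local Open Scope complex_scope.
Local Open Scope quotient_scope.

(** Each core decomposition is finer than the other, because each of the two
quotients has the property that characterizes the other decomposition.

A finitely Suslinian compactum is always a Peano compactum
([suslinian_peano]). Its components are pairwise disjoint continua, so only
finitely many of them are large. If one of them were not locally connected at
a point p, infinitely many components of a small closed ball around p would
come close to p, and each of them would extend to the boundary of the ball
([component_leaves_open]), which gives infinitely many disjoint continua of
large diameter.

Conversely, let M be a Peano compactum that is the quotient of an unshielded K
by a monotone decomposition ([peano_planar_suslinian]). If M were not finitely
Suslinian, some component of M would contain infinitely many disjoint continua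
of large diameter; by compactness and local connectedness, three of them would
meet two disjoint continua P and Q, which are small neighbourhoods of two
distinct points. The projection K -> M is monotone, so preimages of continua are
continua. This gives in the plane three disjoint continua, each meeting two
disjoint continua P and Q, and all of them in the boundary of the connected set
W, the unbounded complementary component. Joining the three continua to P, to Q
and to a point of W would embed the complete bipartite graph on 3 + 3 vertices
in the plane ([no_three_continua]).

That this graph is not planar is proved with angles ([no_planar_K33]), for
arbitrary continuous edges of which only the non-adjacent ones have to be
disjoint. Let x_0, x_1, x_2 be the vertices on one side. For a vertex v on the
other side let h_v be the sum, over the cyclic permutations (i, j, k) of (0, 1, 2), of
the angle by which the edges x_j -> v and then v -> x_k turn around x_i.
Up to full turns, h_v is the sum of the angles of the vectors x_k - x_i minus the
sum of those of the vectors x_j - x_i. These six vectors form three pairs of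
opposite vectors, so h_v is an odd multiple of pi. If v and w are distinct,
choosing the angle of the difference of two non-adjacent edges continuously on a
square gives h_w = - h_v ([turn_square]). With three vertices v this forces
h_v = 0. *)

(** * Angles in the plane *)

Section angles.
Variable R : realType.
Implicit Types (p q : R * R) (a b t : R).

Definition angle_of p t := exists2 r : R, 0 < r & p = (r * cos t, r * sin t).

Lemma angle_of_inj p a b : angle_of p a -> angle_of p b -> cos (a - b) = 1.
Proof.
move=> [r r0 ->] [s s0 [ec es]].
have rs : r = s.
  apply/eqP; rewrite -(eqrXn2 (n := 2)) ?ltW //; apply/eqP.
  rewrite -[LHS]mulr1 -[RHS]mulr1 -{1}(cos2Dsin2 a) -(cos2Dsin2 b) !mulrDr.
  by rewrite -!exprMn ec es.
move: ec es; rewrite rs => /(mulfI (lt0r_neq0 s0)) ec /(mulfI (lt0r_neq0 s0)) es.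
by rewrite cosB ec es -!expr2 cos2Dsin2.
Qed.

Lemma angle_of_opp p a : angle_of p a -> angle_of (- p) (a + pi).
Proof.
by move=> [r r0 ->]; exists r => //; rewrite cosDpi sinDpi !mulrN.
Qed.

Lemma angle_of_right p : 0 < p.1 -> angle_of p (atan (p.2 / p.1)).
Proof.
case: p => x y /= x0; set t := atan _.
have c0 : 0 < cos t by rewrite cos_gt0_pihalf // atan_gtNpi2 atan_ltpi2.
have st : sin t = y / x * cos t.
  by rewrite -[y / x]atanK -/t /tan mulfVK // lt0r_neq0.
exists (x / cos t); first by rewrite divr_gt0.
by rewrite st; congr pair; field; rewrite ?lt0r_neq0.
Qed.

Lemma angle_of_exists p : p != 0 -> exists t, angle_of p t.
Proof.
case: p => x y; rewrite xpair_eqE negb_and /= => xy.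
have [x0|x0|x0] := ltrgtP x 0.
- exists (atan (- y / - x) + pi); rewrite -[(x, y)]opprK.
  by apply: angle_of_opp; apply: angle_of_right => /=; rewrite oppr_gt0.
- by exists (atan (y / x)); apply: angle_of_right.
have [y0|y0|y0] := ltrgtP y 0.
- exists (pi / 2 + pi); rewrite -[(x, y)]opprK; apply: angle_of_opp.
  exists (- y); rewrite ?oppr_gt0 // cos_pihalf sin_pihalf mulr0 mulr1.
  by rewrite x0 /= -[LHS]/(- 0, - y) oppr0.
- by exists (pi / 2), y => //; rewrite cos_pihalf sin_pihalf mulr0 mulr1 x0.
- by move: xy; rewrite x0 y0 eqxx.
Qed.

(** In complex notation the pair is the product of q and the conjugate of p. *)
Lemma angle_of_add p q a b : angle_of p a ->
  angle_of (p.1 * q.1 + p.2 * q.2, p.1 * q.2 - p.2 * q.1) b ->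
  angle_of q (a + b).
Proof.
case: p q => x y [z w] /= [r r0 [-> ->]] [s s0 [e1 e2]].
exists (s / r); first by rewrite divr_gt0.
have cs : cos a ^+ 2 + sin a ^+ 2 = 1 by rewrite cos2Dsin2.
have r_neq0 : r != 0 by rewrite lt0r_neq0.
rewrite cosD sinD; congr pair; apply: (mulfI r_neq0).
  transitivity (r * z * (cos a ^+ 2 + sin a ^+ 2)); first by rewrite cs mulr1.
  transitivity (cos a * (s * cos b) - sin a * (s * sin b)); last by field.
  by rewrite -e1 -e2; ring.
transitivity (r * w * (cos a ^+ 2 + sin a ^+ 2)); first by rewrite cs mulr1.
transitivity (sin a * (s * cos b) + cos a * (s * sin b)); last by field.
by rewrite -e1 -e2; ring.
Qed.

Definition eqmod2pi a b := cos (a - b) = 1.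

Lemma cos1_sin0 a : cos a = 1 -> sin a = 0.
Proof. by move=> ca; apply: cos1sin0; rewrite ca normr1. Qed.

Lemma eqmod2piD a b c d :
  eqmod2pi a b -> eqmod2pi c d -> eqmod2pi (a + c) (b + d).
Proof.
rewrite /eqmod2pi => ab cd.
by rewrite opprD addrACA cosD ab cd (cos1_sin0 ab) mul0r subr0 mulr1.
Qed.

Lemma eqmod2piN a b : eqmod2pi a b -> eqmod2pi (- a) (- b).
Proof. by rewrite /eqmod2pi -opprD cosN. Qed.

End angles.

(** * Continuous choice of an angle *)

Section lifting.
Variable R : realType.
Local Notation plane := (R * R)%type.

Definition clamp (t : R) : R := Num.max 0 (Num.min t 1).

Lemma continuous_clamp : continuous clamp.
Proof.
move=> t; apply: (@continuous_max R R (fun=> 0) (fun s => Num.min s 1)).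
  exact: cvg_cst.
by apply: (@continuous_min R R id (fun=> 1)); [exact: cvg_id|exact: cvg_cst].
Qed.

Lemma clamp_itv t : 0 <= clamp t <= 1.
Proof. by rewrite /clamp le_max lexx /= ge_max ler01 /= ge_min lexx orbT. Qed.

Lemma clamp_le0 t : t <= 0 -> clamp t = 0.
Proof.
move=> t0; rewrite /clamp max_l // ge_min t0 //.
Qed.

Lemma clamp_ge1 t : 1 <= t -> clamp t = 1.
Proof. by move=> t1; rewrite /clamp min_r // max_r. Qed.

Lemma clamp_id t : 0 <= t <= 1 -> clamp t = t.
Proof. by move=> /andP[t0 t1]; rewrite /clamp min_l // max_r. Qed.

Lemma clamp_const (T : Type) (f : R -> T) t :
  (forall s, s <= 0 -> f s = f 0) -> (forall s, 1 <= s -> f s = f 1) ->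
  f (clamp t) = f t.
Proof.
move=> f0 f1; have [t0|t0] := leP t 0; first by rewrite clamp_le0 ?f0.
have [t1|t1] := leP 1 t; first by rewrite clamp_ge1 ?f1.
by rewrite clamp_id // !ltW.
Qed.

Definition clamp2 (p : plane) : plane := (clamp p.1, clamp p.2).

Lemma continuous_idfun (T : topologicalType) : continuous (fun x : T => x).
Proof. by move=> x; exact: cvg_id. Qed.

Lemma continuous_fst_comp (T : topologicalType) (A B : topologicalType) (f : T -> A * B) :
  continuous f -> continuous (fun x => (f x).1).
Proof. by move=> cf x; apply: (cvg_comp f fst (cf x)); exact: cvg_fst. Qed.

Lemma continuous_snd_comp (T : topologicalType) (A B : topologicalType) (f : T -> A * B) :
  continuous f -> continuous (fun x => (f x).2).
Proof. by move=> cf x; apply: (cvg_comp f snd (cf x)); exact: cvg_snd. Qed.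

Lemma continuous_pair (T A B : topologicalType) (f : T -> A) (g : T -> B) :
  continuous f -> continuous g -> continuous (fun x => (f x, g x)).
Proof. by move=> cf cg x; apply: cvg_pair; [exact: cf|exact: cg]. Qed.

Lemma continuous_compose (T A B : topologicalType) (f : T -> A) (g : A -> B) :
  continuous f -> continuous g -> continuous (fun x => g (f x)).
Proof. by move=> cf cg x; apply: (cvg_comp f g (cf x)); exact: cg. Qed.

Lemma continuous_clamp2 : continuous clamp2.
Proof.
apply: continuous_pair; apply: continuous_compose; try exact: continuous_clamp.
  by apply: continuous_fst_comp; exact: continuous_idfun.
by apply: continuous_snd_comp; exact: continuous_idfun.
Qed.

Definition dot (p q : plane) : R := p.1 * q.1 + p.2 * q.2.
Definition cross (p q : plane) : R := p.1 * q.2 - p.2 * q.1.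

Lemma continuous_dot (T : topologicalType) (f g : T -> plane) :
  continuous f -> continuous g -> continuous (fun x => dot (f x) (g x)).
Proof.
by move=> cf cg x; apply: cvgD; apply: cvgM;
  (apply: continuous_fst_comp || apply: continuous_snd_comp).
Qed.

Lemma continuous_cross (T : topologicalType) (f g : T -> plane) :
  continuous f -> continuous g -> continuous (fun x => cross (f x) (g x)).
Proof.
by move=> cf cg x; apply: cvgB; apply: cvgM;
  (apply: continuous_fst_comp || apply: continuous_snd_comp).
Qed.

Lemma dot_gt0 p : p != 0 -> 0 < dot p p.
Proof.
case: p => x y; rewrite xpair_eqE negb_and /= /dot /= -!expr2 => /orP[n0|n0].
  by apply: ltr_pwDl; rewrite ?exprn_even_gt0 ?sqr_ge0.
by apply: ltr_pwDr; rewrite ?exprn_even_gt0 ?sqr_ge0.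
Qed.

(** The maps [fun p => u (t *: p)] contract u to a constant. By compactness of the
unit square, two stages at distance [n.+1%:R^-1] make an acute angle everywhere. *)
Lemma dot_homotopy_gt0 (u : plane -> plane) :
  continuous u -> (forall p, u p != 0) ->
  exists n : nat, forall (t : R) (p : plane), 0 <= t <= 1 ->
    0 < dot (u (t *: clamp2 p)) (u ((t + n.+1%:R^-1) *: clamp2 p)).
Proof.
move=> cu u0.
pose I01 : set R := `[0, 1]%classic.
have cI : compact (I01 `*` (I01 `*` I01)).
  by apply: compact_setX; [|apply: compact_setX]; exact: segment_compact.
pose G (z : (R * plane) * R) :=
  dot (u (z.1.1 *: z.1.2)) (u ((z.1.1 + z.2) *: z.1.2)).
have cG : continuous G.
  have c1 : continuous (fun z : (R * plane) * R => z.1).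
    by apply: continuous_fst_comp; exact: continuous_idfun.
  have c11 := continuous_fst_comp c1; have c12 := continuous_snd_comp c1.
  have c2 : continuous (fun z : (R * plane) * R => z.2).
    by apply: continuous_snd_comp; exact: continuous_idfun.
  apply: continuous_dot; apply: continuous_compose => //.
    by move=> z; apply: cvgZ; [exact: c11|exact: c12].
  by move=> z; apply: cvgZ; [apply: cvgD; [exact: c11|exact: c2]|exact: c12].
have := (compact_near_coveringP _).1 cI R (nbhs (0 : R))
  (fun s x => 0 < G (x, s)) _.
case=> [x _|e /= e0 He].
  have Gx : 0 < G (x, 0) by rewrite /G /= addr0 dot_gt0.
  have := cG (x, 0) [set y | 0 < y]; apply.
  by apply: open_nbhs_nbhs; split => //; exact: open_gt.
have [n _ /(_ n (leqnn n)) /= ne] := near_infty_natSinv_lt (PosNum e0).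
exists n => t p t01; have ne' : ball 0 e (n.+1%:R^-1 : R).
  by rewrite /ball /= sub0r normrN gtr0_norm.
by have /= := He _ ne' (t, clamp2 p); apply; split; rewrite /I01 /= ?in_itv //=;
  split; rewrite /= ?in_itv /= clamp_itv.
Qed.

(** The angles between consecutive stages of the contraction are given by the
arctangent, hence continuous, and they add up to an angle of u. The hypothesis
on [clamp2] says that u is determined by its values on the unit square. *)
Lemma angle_lift (u : plane -> plane) :
  continuous u -> (forall p, u p != 0) -> (forall p, u (clamp2 p) = u p) ->
  exists2 a : plane -> R, continuous a & forall p, angle_of (u p) (a p).
Proof.
move=> cu u0 uc; have [n un] := dot_homotopy_gt0 cu u0.
have [a0 Ha0] := angle_of_exists (u0 0).
pose v k p := u ((k%:R / n.+1%:R) *: clamp2 p).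
pose step k p := atan (cross (v k p) (v k.+1 p) / dot (v k p) (v k.+1 p)).
have cv k : continuous (v k).
  apply: continuous_compose => // p; apply: cvgZ; first exact: cvg_cst.
  exact: continuous_clamp2.
have v_gt0 k p : (k < n.+1)%N -> 0 < dot (v k p) (v k.+1 p).
  move=> kn; rewrite /v.
  have -> : k.+1%:R / n.+1%:R = k%:R / n.+1%:R + n.+1%:R^-1 :> R.
    by rewrite -natr1 mulrDl mul1r.
  by apply: un; rewrite divr_ge0 //= ler_pdivrMr ?ltr0Sn // mul1r ler_nat ltnW.
exists (fun p => a0 + \sum_(k < n.+1) step k p).
  move=> p; apply: cvgD; first exact: cvg_cst.
  apply: (continuous_big (@add_continuous R)) => k _.
  apply: (continuous_compose (g := @atan R)); last by move=> t; exact: continuous_atan.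
  move=> q; apply: cvgM; first exact: continuous_cross.
  by apply: cvgV; [rewrite lt0r_neq0 // v_gt0|exact: continuous_dot].
move=> p; suff H k : (k <= n.+1)%N -> angle_of (v k p) (a0 + \sum_(i < k) step i p).
  by have := H _ (leqnn _); rewrite /v divff ?pnatr_eq0 // scale1r uc.
elim: k => [_|k IH kn]; first by rewrite big_ord0 addr0 /v mul0r scale0r.
rewrite big_ord_recr /= addrA; apply: angle_of_add (IH (ltnW kn)) _.
by apply: angle_of_right; exact: v_gt0.
Qed.

(** The two choices differ by a continuous function with values in the multiples of
2 pi. *)
Lemma angle_lift_unique (v : R -> plane) (a b : R -> R) :
  continuous a -> continuous b ->
  (forall t, angle_of (v t) (a t)) -> (forall t, angle_of (v t) (b t)) ->
  a 1 - a 0 = b 1 - b 0.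
Proof.
move=> ca cb Ha Hb; pose d t := (a t - b t) - (a 0 - b 0).
have cd : continuous d.
  move=> t; apply: cvgB; last exact: cvg_cst.
  by apply: cvgB; [exact: ca|exact: cb].
have dE t : cos (d t) = 1.
  have := eqmod2piD (angle_of_inj (Ha t) (Hb t))
    (eqmod2piN (angle_of_inj (Ha 0) (Hb 0))).
  rewrite /eqmod2pi /d; congr (cos _ = 1); ring.
suff d1 : d 1 = 0 by move: d1; rewrite /d => d1; lra.
have d0 : d 0 = 0 by rewrite /d; ring.
apply/eqP/negPn/negP; rewrite -normr_gt0 => d1.
(* a value strictly between 0 and 2 pi that the distance of a t - b t from its
initial value would have to take *)
pose v0 := Num.min `|d 1| (pi / 2).
have pi0 := pi_gt0 R.
have v0_gt0 : 0 < v0 by rewrite lt_min d1 divr_gt0.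
have := @IVT R (fun t => `|d t|) 0 1 v0 ler01.
case=> [||t _ dt].
- apply: continuous_subspaceT => t.
  by apply: cvg_norm; exact: cd.
- by rewrite d0 normr0 min_l ?max_r ?(ltW d1) // (ltW v0_gt0) /= /v0 ge_min lexx.
have : cos v0 = cos 0 by rewrite -dt cos_norm dE cos0.
move=> /cos_inj v00; suff : v0 = 0 by move=> v0E; rewrite v0E ltxx in v0_gt0.
apply: v00; rewrite in_itv /= ?lexx ?(ltW pi0) ?(ltW v0_gt0) //=.
rewrite /v0 ge_min; apply/orP; right.
by rewrite ler_pdivrMr // ler_pMr //; lra.
Qed.

(** * Paths and the angle they turn through *)

(** Paths are constant outside the unit interval, so that no domain has to be
mentioned and concatenation is a sum of continuous functions. *)
Definition is_path (V : topologicalType) (f : R -> V) (x y : V) :=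
  [/\ continuous f, forall t, t <= 0 -> f t = x & forall t, 1 <= t -> f t = y].

Lemma path_start (V : topologicalType) (f : R -> V) x y :
  is_path f x y -> f 0 = x.
Proof. by case=> _ + _; apply. Qed.

Lemma path_end (V : topologicalType) (f : R -> V) x y : is_path f x y -> f 1 = y.
Proof. by case=> _ _; apply. Qed.

Lemma path_clamp (V : topologicalType) (f : R -> V) x y t :
  is_path f x y -> f (clamp t) = f t.
Proof.
case=> _ fx fy; apply: clamp_const => s hs; first by rewrite !fx.
by rewrite !fy.
Qed.

Lemma compact_path (V : topologicalType) (f : R -> V) x y :
  is_path f x y -> compact (range f).
Proof.
move=> pf; have -> : range f = f @` `[0, 1]%classic.
  apply/seteqP; split=> [_ [t _ <-]|_ [t _ <-]]; last by exists t.
  by exists (clamp t); [rewrite /= in_itv /= clamp_itv|exact: path_clamp pf].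
apply: continuous_compact; last exact: segment_compact.
by apply: continuous_subspaceT; case: pf.
Qed.

(** The increment of the angle of f - x over the path; the default value is only
taken when f passes through x. *)
Definition turn (f : R -> plane) (x : plane) : R :=
  xget 0 [set d | exists a : R -> R, [/\ continuous a,
    forall t, angle_of (f t - x) (a t) & d = a 1 - a 0]].

Lemma turnE (f : R -> plane) (x : plane) (a : R -> R) : continuous a ->
  (forall t, angle_of (f t - x) (a t)) -> turn f x = a 1 - a 0.
Proof.
move=> ca Ha; rewrite /turn; case: xgetP => [d -> [b [cb Hb ->]]|].
  exact: angle_lift_unique Hb Ha.
by move=> /(_ (a 1 - a 0)) []; exists a.
Qed.

Lemma path_pair_lift (e f : R -> plane) x a y b :
  is_path e x a -> is_path f y b -> (forall s t, e s <> f t) ->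
  exists2 A : plane -> R, continuous A &
    forall s t, angle_of (f t - e s) (A (s, t)).
Proof.
move=> pe pf ef; pose u (p : plane) := f p.2 - e p.1.
have [||p|A cA HA] := @angle_lift u.
- case: pe pf => ce _ _ [cf _ _] p; apply: cvgB.
    exact: (continuous_compose (continuous_snd_comp (@continuous_idfun _)) cf).
  exact: (continuous_compose (continuous_fst_comp (@continuous_idfun _)) ce).
- by move=> p; rewrite subr_eq0; apply/eqP => /esym; exact: ef.
- by rewrite /u /= (path_clamp _ pe) (path_clamp _ pf).
by exists A => // s t; exact: (HA (s, t)).
Qed.

(** The angle of f t - e s can be chosen continuously on the square of the pairs
(s, t); its increments along the four sides of the square add up to zero, and
replacing a vector by its opposite does not change the increment. *)
Lemma turn_square (e f : R -> plane) x a y b :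
  is_path e x a -> is_path f y b -> (forall s t, e s <> f t) ->
  turn f x - turn f a = turn e y - turn e b.
Proof.
move=> pe pf ef; have [A cA HA] := path_pair_lift pe pf ef.
have cpair (g h : R -> R) : continuous g -> continuous h ->
    continuous (fun t => A (g t, h t)).
  by move=> cg ch; apply: (continuous_compose _ cA); exact: continuous_pair.
have cc (c : R) : continuous (fun _ : R => c) by move=> t; exact: cvg_cst.
have ci := @continuous_idfun R.
have turnf s : turn f (e s) = A (s, 1) - A (s, 0).
  by apply: (@turnE _ _ (fun t => A (s, t))) => //; exact: cpair.
have turne t : turn e (f t) = A (1, t) - A (0, t).
  rewrite (@turnE _ _ (fun s => A (s, t) + pi)); first by rewrite /=; ring.
    by move=> s; apply: cvgD; [exact: cpair|exact: cvg_cst].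
  by move=> s; rewrite -opprB; exact: angle_of_opp.
rewrite -{1}(path_start pe) -(path_end pe) -(path_start pf) -(path_end pf).
by rewrite !turnf !turne; ring.
Qed.

Lemma turn_mod (e : R -> plane) x a y p q : is_path e x a ->
  (forall s, e s <> y) -> angle_of (x - y) p -> angle_of (a - y) q ->
  eqmod2pi (turn e y) (q - p).
Proof.
move=> pe ey xp aq.
have [A cA HA] : exists2 A : plane -> R, continuous A &
    forall s t, angle_of (e t - y) (A (s, t)).
  have py : is_path (fun=> y) y y by split=> // t; exact: cvg_cst.
  have [|A cA HA] := @path_pair_lift (fun=> y) e y y x a py pe.
    by move=> s t /esym; exact: ey.
  by exists A.
rewrite (@turnE e y (fun t => A (0, t))) //.
  apply: eqmod2piD.
    by apply: angle_of_inj aq; rewrite -(path_end pe).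
  by apply: eqmod2piN; apply: angle_of_inj xp; rewrite -(path_start pe).
apply: (continuous_compose _ cA); apply: continuous_pair.
  by move=> t; exact: cvg_cst.
exact: continuous_idfun.
Qed.

End lifting.

(** * The complete bipartite graph on three and three vertices *)

Section K33.
Variable R : realType.
Local Notation plane := (R * R)%type.
Variables (x p : 'I_3 -> plane) (e : 'I_3 -> 'I_3 -> R -> plane).
Hypothesis e_path : forall i v, is_path (e i v) (x i) (p v).
Hypothesis e_disj : forall i j v w, i != j -> v != w ->
  forall s t, e i v s <> e j w t.

(** The sum of the angles by which the path from x_j to p v and back to x_k turns
around x_i, over the cyclic permutations (i, j, k) of (0, 1, 2). *)
Let turning v :=
  turn (e 1 v) (x 0) - turn (e 2 v) (x 0) + (turn (e 2 v) (x 1) -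
  turn (e 0 v) (x 1)) + (turn (e 0 v) (x 2) - turn (e 1 v) (x 2)).

Let other (v : 'I_3) : exists w, w != v.
Proof. by exists (v + 1); case: v => [[|[|[|//]]]] ?. Qed.

(** The alternating sum over all pairs (i, j) of the relations given by
[turn_square]: the terms that involve turning around p v and p w cancel. *)
Let turning_opp v w : v != w -> turning w = - turning v.
Proof.
move=> vw.
have E i j : i != j ->
    turn (e j w) (x i) - turn (e j w) (p v) =
    turn (e i v) (x j) - turn (e i v) (p w).
  by move=> ij; apply: turn_square => //; exact: e_disj.
have := E 0 1 isT; have := E 1 0 isT; have := E 0 2 isT; have := E 2 0 isT.
have := E 1 2 isT; have := E 2 1 isT; rewrite /turning; lra.
Qed.

(** Modulo full turns the angles of the vectors p v - x_i cancel, and what remains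
is the difference between the angles of x_j - x_i and of x_i - x_j, for three
pairs. *)
Let turning_odd v : eqmod2pi (turning v) pi.
Proof.
have [w wv] := other v.
have ex i j s : i != j -> e j v s <> x i.
  move=> ij; rewrite -(path_start (e_path i w)); apply: e_disj.
    by rewrite eq_sym.
  by rewrite eq_sym.
have px i : p v - x i != 0.
  rewrite subr_eq0; have [j ji] := other i.
  rewrite -(path_end (e_path j v)); apply/eqP; apply: ex; by rewrite eq_sym.
have xx i j : i != j -> x j - x i != 0.
  move=> ij; rewrite subr_eq0 -(path_start (e_path j v)).
  by apply/eqP; exact: ex.
have [a0 A0] := angle_of_exists (px 0).
have [a1 A1] := angle_of_exists (px 1).
have [a2 A2] := angle_of_exists (px 2).
have [b01 B01] := angle_of_exists (xx 0 1 isT).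
have [b02 B02] := angle_of_exists (xx 0 2 isT).
have [b12 B12] := angle_of_exists (xx 1 2 isT).
have B10 := angle_of_opp B01; rewrite opprB in B10.
have B20 := angle_of_opp B02; rewrite opprB in B20.
have B21 := angle_of_opp B12; rewrite opprB in B21.
have T i j b a : i != j -> angle_of (x j - x i) b -> angle_of (p v - x i) a ->
    eqmod2pi (turn (e j v) (x i)) (a - b).
  by move=> ij; apply: turn_mod => // s; exact: ex.
have := eqmod2piD (eqmod2piD
  (eqmod2piD (T 0 1 _ _ isT B01 A0) (eqmod2piN (T 0 2 _ _ isT B02 A0)))
  (eqmod2piD (T 1 2 _ _ isT B12 A1) (eqmod2piN (T 1 0 _ _ isT B10 A1))))
  (eqmod2piD (T 2 0 _ _ isT B20 A2) (eqmod2piN (T 2 1 _ _ isT B21 A2))).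
rewrite /turning; congr (eqmod2pi _ _); ring.
Qed.

(** The sums for three vertices are pairwise opposite, hence zero, which is not an odd
multiple of pi. *)
Lemma no_planar_K33 : False.
Proof.
have h01 := turning_opp (v := 0) (w := 1) isT.
have h02 := turning_opp (v := 0) (w := 2) isT.
have h12 := turning_opp (v := 1) (w := 2) isT.
have h0 : turning 0 = 0 by lra.
have := turning_odd 0; rewrite h0 /eqmod2pi sub0r cosN cospi => H; lra.
Qed.

End K33.

(** * Boundary bumping *)

Section connected_closure.
Variable X : topologicalType.
Implicit Types (A B S T U : set X) (x : X).

Lemma connected_sub_closure S T :
  connected S -> S `<=` T -> T `<=` closure S -> connected T.
Proof.
move=> cS ST TS B [b Bb] [C oC BC] [D cD BD].
have [[s [Ss Cs]]|SC] := pselect (S `&` C !=set0).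
  have SCS : S `&` C = S.
    apply: cS; [by exists s|by exists C|exists D => //].
    apply/seteqP; split=> y [Sy yCD]; split=> //.
      suff : B y by rewrite BD => -[].
      by rewrite BC; split => //; exact: ST.
    suff : B y by rewrite BC => -[].
    by rewrite BD; split => //; exact: ST.
  have SD : S `<=` D.
    move=> y; rewrite -SCS => -[Sy Cy].
    suff : B y by rewrite BD => -[].
    by rewrite BC; split => //; exact: ST.
  apply/seteqP; split=> [y|y Ty]; first by rewrite BC => -[].
  rewrite BD; split => //; rewrite (closure_id D).1 //.
  exact: closureS SD _ (TS _ Ty).
exfalso; apply: SC; have [Tb Cb] : (T `&` C) b by rewrite -BC.
by have [y [Sy Cy]] := TS _ Tb C (open_nbhs_nbhs (conj oC Cb)); exists y.
Qed.

Lemma separated_closed (E : bool -> set X) :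
  separated (E false) (E true) -> closed (E false `|` E true) ->
  forall b, closed (E b).
Proof.
move=> [sep1 sep2] cE b; rewrite closure_id; apply/seteqP.
split; first exact: subset_closure.
move=> y Ey; have : (E false `|` E true) y.
  rewrite (closure_id (E false `|` E true)).1 //.
  by apply: closureS Ey; case: b => z; [right|left].
case: b Ey => Ey [] // Ey'.
  by have : (E false `&` closure (E true)) y by []; rewrite sep2.
by have : (closure (E false) `&` E true) y by []; rewrite sep1.
Qed.

End connected_closure.

Section boundary_bumping.
Variables (R : realType) (X : pseudoMetricType R).
Hypothesis hX : hausdorff_space X.
Implicit Types (A B E N P Q S T U : set X) (x : X).


Let normal_sep A B : closed A -> closed B -> A `&` B = set0 ->
  exists U V, [/\ open U, open V, A `<=` U, B `<=` V & U `&` V = set0].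
Proof. exact: (@normal_openP R X).1 pseudometric_normal _ _. Qed.

(** The pieces of B around x that are both open and closed in B form a filter
base; by compactness they shrink into any open set containing their
intersection, and that intersection is connected. *)
Lemma component_clopen B x U : compact B -> B x -> open U ->
  connected_component B x `<=` U ->
  exists E, [/\ E x, E `<=` B `&` U, closed E & closed (B `\` E)].
Proof.
move=> kB Bx oU CU; have cB := compact_closed hX kB.
pose clo (E : set X) := [/\ E x, E `<=` B, closed E & closed (B `\` E)].
have cloB : clo B by split=> //; rewrite setDv; exact: closed0.
have cloI E F : clo E -> clo F -> clo (E `&` F).
  move=> [Ex EB cE cBE] [Fx FB cF cBF]; split=> //.
  - by move=> y [/EB].
  - exact: closedI.
  - by rewrite setDIr; exact: closedU.
pose Q := \bigcap_(E in clo) E.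
have shrink O : open O -> Q `<=` O -> exists2 E, clo E & E `<=` O.
  move=> oO QO; apply: contrapT => noE.
  pose F := filter_from clo (fun E => E `\` O).
  have FF : ProperFilter F.
    apply: filter_from_proper; last first.
      move=> E cE; apply: contrapT => E0; apply: noE; exists E => // y Ey.
      by apply: contrapT => nOy; apply: E0; exists y.
    apply: filter_from_filter; first by exists B.
    move=> E E' cE cE'; exists (E `&` E'); first exact: cloI.
    by move=> y [[Ey E'y] Oy].
  have [z [Bz clz]] : B `&` cluster F !=set0.
    by apply: kB; exists B => // y [].
  have EO E : clo E -> (E `\` O) z.
    move=> cE; have cEO : closed (E `\` O).
      by case: cE => _ _ cE _; apply: closedI => //; exact: open_closedC.
    rewrite (closure_id (E `\` O)).1 //; move: clz; rewrite clusterE; apply.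
    by exists E.
  have [_ nOz] := EO _ cloB; by apply: nOz; apply: QO => G /EO [].
have Qx : Q x by move=> G [].
have QB : Q `<=` B by move=> y /(_ B cloB).
have cQ : closed Q by apply: closed_bigI => E [].
have Q_conn : connected Q.
  apply/connectedP => E [E0 QE sepE].
  have cE : forall b, closed (E b) by apply: separated_closed => //; rewrite -QE.
  have E01 := separated_disjoint sepE.
  clear sepE.
  wlog : E E0 QE cE E01 / E false x.
    move=> W; have := Qx; rewrite {1}QE => -[Ex|Ex]; first exact: (W E).
    apply: (W (fun b => E (~~ b))) => //=.
    - by rewrite setUC.
    - by rewrite setIC.
  move=> Ex.
  have [U1 [U2 [oU1 oU2 EU1 EU2 U12]]] := normal_sep (cE _) (cE _) E01.
  have [|G [Gx GB cG cBG] GO] := shrink (U1 `|` U2) (openU oU1 oU2).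
    by rewrite QE => y [/EU1|/EU2]; [left|right].
  have U12' y : U1 y -> U2 y -> False.
    by move=> y1 y2; have : (U1 `&` U2) y by []; rewrite U12.
  have clo1 : clo (G `\` U2).
    split.
    - by split=> // U2x; apply: (U12' x) => //; exact: EU1.
    - by move=> y [/GB].
    - by apply: closedI => //; exact: open_closedC.
    - have -> : B `\` (G `\` U2) = (B `\` G) `|` (G `\` U1).
        apply/seteqP; split=> y /=.
          move=> [By nG]; have [Gy|Gy] := pselect (G y); last by left.
          right; split=> // U1y; apply: nG; split=> // U2y.
          exact: (U12' y).
        move=> [[By nG]|[Gy nU1]]; first by split=> // -[].
        split; first exact: GB.
        by case=> _; apply; have [] := GO _ Gy.
      by apply: closedU => //; apply: closedI => //; exact: open_closedC.
  have [y Ey] := E0 true.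
  have Qy : Q y by rewrite QE; right.
  by have [_ []] := Qy _ clo1; exact: EU2.
have [|E [Ex EB cE cBE] EU] := shrink U oU.
  by apply: subset_trans CU; exact: connected_component_max.
by exists E; split=> // y Ey; split; [exact: EB|exact: EU].
Qed.

(** Otherwise a part of B that is open and closed in B and lies in U would be open
and closed in A. *)
Lemma component_leaves_open A B U x : connected A -> compact B ->
  A `&` U `<=` B -> B `<=` A -> open U -> U x -> A x -> ~ (A `<=` U) ->
  ~ (connected_component B x `<=` U).
Proof.
move=> conA kB AUB BA oU Ux Ax nAU CU; apply: nAU.
have [|E [Ex EBU cE cBE]] := component_clopen kB _ oU CU; first exact: AUB.
rewrite -(conA E); first by move=> y /EBU [].
- by exists x.
- exists (U `&` ~` (B `\` E)); first by apply: openI => //; exact: closed_openC.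
  apply/seteqP; split=> [y Ey|y [Ay [Uy nBE]]].
    have [By Uy] := EBU _ Ey; split; [exact: BA|split => // -[_]; exact].
  by apply: contrapT => nE; apply: nBE; split=> //; exact: AUB.
- exists E => //; apply/seteqP; split=> [y Ey|y []//]; split=> //.
  by have [/BA] := EBU _ Ey.
Qed.

(** Boundary bumping: if the closure missed N, disjoint open neighbourhoods U of the
closure and V of N would contradict [component_leaves_open], with the part of A
outside V for B. *)
Lemma component_reaches A N x : compact A -> connected A -> closed N ->
  A x -> ~ N x -> A `&` N !=set0 ->
  closure (connected_component (A `\` N) x) `&` N !=set0.
Proof.
move=> kA conA cN Ax Nx [n [An Nn]]; apply: contrapT => /nonemptyPn S0.
set S := connected_component _ _ in S0.
have [U [V [oU oV SU NV UV]]] := normal_sep (@closed_closure _ S) cN S0.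
have UV' y : U y -> V y -> False.
  by move=> y1 y2; have : (U `&` V) y by []; rewrite UV.
have cA := compact_closed hX kA.
have Sx : S x by apply: connected_component_refl.
have BA : A `\` V `<=` A by move=> y [].
apply: (@component_leaves_open A (A `\` V) U x) => //.
- apply: subclosed_compact kA BA.
  by apply: closedI => //; exact: open_closedC.
- by move=> y [Ay Uy]; split=> //; exact: UV'.
- by apply: SU; exact: subset_closure.
- by move=> /(_ n An) Un; apply: (UV' n) => //; exact: NV.
apply: (subset_trans _ SU); apply: (subset_trans _ (@subset_closure _ S)).
apply: connected_component_max.
- apply: connected_component_refl; split=> //; apply: UV'.
  by apply: SU; exact: subset_closure.
- by move=> y /connected_component_sub [Ay nVy]; split=> // /NV.
- exact: component_connected.
Qed.

(** A substitute for an arc from P to Q inside A. The set S is a component of A off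
Q that meets P, and T is a component of the closure of S off P that meets Q. If
T did not meet S, it would lie in the closure of S but not in S, hence in Q; but
its closure meets P. *)
Lemma continuum_crossing A P Q : compact A -> connected A ->
  closed P -> closed Q -> P `&` Q = set0 -> A `&` P !=set0 -> A `&` Q !=set0 ->
  exists x S T, [/\ connected S /\ connected T, S `<=` A `\` Q, T `<=` A `\` P,
    S x /\ T x & S `&` P !=set0 /\ T `&` Q !=set0].
Proof.
move=> kA conA cP cQ PQ0 [p [Ap Pp]] AQ; have cA := compact_closed hX kA.
have PQ y : P y -> Q y -> False.
  by move=> y1 y2; have : (P `&` Q) y by []; rewrite PQ0.
set S := connected_component (A `\` Q) p.
have conS : connected S by exact: component_connected.
have Sp : S p by apply: connected_component_refl; split=> //; exact: PQ.
have [q [Sq Qq]] := component_reaches kA conA cQ Ap (PQ p Pp) AQ.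
set E := closure S; have SA : S `<=` A by move=> y /connected_component_sub [].
have EA : E `<=` A by rewrite (closure_id A).1 //; exact: closureS.
have kE : compact E by apply: subclosed_compact kA EA; exact: closed_closure.
have conE : connected E by exact: connected_closure.
set T := connected_component (E `\` P) q.
have nPq : ~ P q by move/PQ; exact.
have EP : E `&` P !=set0 by exists p; split=> //; exact: subset_closure.
have [r [Tr Pr]] := component_reaches kE conE cP Sq nPq EP.
have TE : T `<=` E `\` P by exact: connected_component_sub.
have [x [Sx Tx]] : S `&` T !=set0.
  apply: contrapT => ST; apply: (PQ r) => //.
  rewrite (closure_id Q).1 //; apply: closureS Tr => y Ty.
  apply: contrapT => nQy; apply: ST; exists y; split=> //.
  have [Ey _] := TE _ Ty.
  exists (S `|` [set y]); last by right.
  split; first by left.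
    move=> z [/connected_component_sub//|->]; split=> //; exact: EA.
  apply: (connected_sub_closure conS); first by move=> z; left.
  by move=> z [/subset_closure//|->].
exists x, S, T; split=> //.
- by split=> //; exact: component_connected.
- exact: connected_component_sub.
- by move=> y /TE [/EA].
- split; first by exists p.
  by exists q; split=> //; apply: connected_component_refl.
Qed.

End boundary_bumping.

(** * Paths in open sets *)

Section joining.
Variables (R : realType) (V : normedModType R).
Implicit Types (U S : set V) (x y z : V).

Definition joined U x y :=
  exists2 f : R -> V, is_path f x y & forall t, U (f t).

Lemma joined_sym U x y : joined U x y -> joined U y x.
Proof.
move=> [f [cf f0 f1] Uf]; exists (fun t => f (1 - t)) => //; split.
- apply: (continuous_compose _ cf) => t; apply: cvgB; [exact: cvg_cst|exact: cvg_id].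
- by move=> t t0; apply: f1; lra.
- by move=> t t1; apply: f0; lra.
Qed.

Lemma joined_trans U x y z : joined U x y -> joined U y z -> joined U x z.
Proof.
move=> [f [cf f0 f1] Uf] [g [cg g0 g1] Ug].
have left t : t <= 1 / 2 -> f (2 * t) + (g (2 * t - 1) - y) = f (2 * t).
  by move=> ht; rewrite g0 ?subrr ?addr0 //; lra.
have right t : 1 / 2 <= t -> f (2 * t) + (g (2 * t - 1) - y) = g (2 * t - 1).
  by move=> ht; rewrite f1; [rewrite addrC subrK|lra].
exists (fun t => f (2 * t) + (g (2 * t - 1) - y)); last first.
  move=> t; have [ht|/ltW ht] := leP t (1 / 2); first by rewrite left.
  by rewrite right.
have c2 : continuous (fun t : R => 2 * t).
  by move=> t; apply: cvgM; [exact: cvg_cst|exact: cvg_id].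
split.
- move=> t; apply: cvgD; first exact: (continuous_compose c2 cf).
  apply: cvgB; last exact: cvg_cst.
  have c3 : continuous (fun s : R => 2 * s - 1).
    by move=> s; apply: cvgB; [exact: c2|exact: cvg_cst].
  exact: (continuous_compose c3 cg).
- by move=> t ht; rewrite left ?f0 //; lra.
- by move=> t ht; rewrite right ?g1 //; lra.
Qed.

Lemma joined_ball U x y r : ball x r `<=` U -> ball x r y -> joined U x y.
Proof.
move=> xU xy; exists (fun t => x + clamp t *: (y - x)).
  split=> [t|t t0|t t1]; last 2 first.
  - by rewrite clamp_le0 // scale0r addr0.
  - by rewrite clamp_ge1 // scale1r addrC subrK.
  apply: cvgD; first exact: cvg_cst.
  by apply: cvgZ; [exact: continuous_clamp|exact: cvg_cst].
move=> t; apply: xU; move: xy; rewrite -!ball_normE /ball_ /=; apply: le_lt_trans.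
rewrite opprD addNKr normrN normrZ distrC; have /andP[c0 c1] := clamp_itv t.
by rewrite ger0_norm // ler_piMl.
Qed.

(** The points that can be reached from a given point form a set that is open
and has an open complement in U. *)
Lemma connected_joined U S x y :
  open U -> connected S -> S `<=` U -> S x -> S y -> joined U x y.
Proof.
move=> oU cS SU Sx Sy.
have near_joined z : U z -> exists2 r : {posnum R},
    ball z r%:num `<=` U & forall w, ball z r%:num w -> joined U z w.
  move=> Uz; have /nbhs_ballP[r /= r0 rU] := open_nbhs_nbhs (conj oU Uz).
  by exists (PosNum r0) => //= w; exact: joined_ball.
pose C := [set z | joined U x z]; pose D := U `\` C.
have oC : open C.
  rewrite openE => z Cz; have Uz : U z.
    by case: Cz => f pf Uf; rewrite -(path_end pf).
  have [r _ rz] := near_joined z Uz; apply/nbhs_ballP; exists r%:num => //= w /rz.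
  exact: joined_trans.
have oD : open D.
  rewrite openE => z [Uz nCz]; have [r rU rz] := near_joined z Uz.
  apply/nbhs_ballP; exists r%:num => //= w zw; split; first exact: rU.
  by move=> Cw; apply: nCz; apply: joined_trans Cw _; apply: joined_sym; exact: rz.
suff : S `&` C = S by move=> SC; have [] : (S `&` C) y by rewrite SC.
apply: cS; [|by exists C|exists (~` D); first exact: open_closedC].
  exists x; split=> //; exists (fun=> x); last by move=> _; exact: SU.
  by split=> // t; exact: cvg_cst.
apply/seteqP; split=> z [Sz]; first by move=> Cz; split=> // -[].
by move=> nDz; split=> //; apply: contrapT => nCz; apply: nDz; split=> //; exact: SU.
Qed.

End joining.

(** * Three continua between two continua *)

Section three_continua.
Variable R : realType.
Local Notation plane := (R * R)%type.

Let hplane : hausdorff_space plane.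
Proof. exact: norm_hausdorff. Qed.

Let avoid (F S : set plane) x y : closed F -> connected S ->
  (forall z, S z -> ~ F z) -> S x -> S y ->
  exists2 f : R -> plane, is_path f x y & forall t, ~ F (f t).
Proof. by move=> cF cS SF; exact: connected_joined (closed_openC cF) cS SF. Qed.

Let closed_range (f : R -> plane) x y : is_path f x y -> closed (range f).
Proof. by move=> /compact_path; exact: compact_closed. Qed.

Let closed_others (F : 'I_3 -> set plane) (D : set 'I_3) :
  (forall j, closed (F j)) -> closed (\bigcup_(j in D) F j).
Proof. by move=> cF; apply: closed_bigcup; [exact: finite_finset|move=> j _]. Qed.

(** The graph to be excluded has the vertices x_i, one on each A_i, on one side and a
point of P, a point of Q and a point of W on the other side. Its edges are chosen
one after the other, each in an open set that contains a suitable connected set and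
avoids the closed sets that matter: f_i close to W and x_i, then g_i and h_i close
to A_i, towards P and towards Q, prolonged by n_i close to P and by m_i close to
Q. *)
Lemma no_three_continua (A : 'I_3 -> set plane) (P Q W : set plane) :
  (forall i, compact (A i) /\ connected (A i)) ->
  (forall i j, i != j -> A i `&` A j = set0) ->
  compact P -> connected P -> compact Q -> connected Q -> P `&` Q = set0 ->
  (forall i, A i `&` P !=set0) -> (forall i, A i `&` Q !=set0) ->
  connected W -> W `&` (P `|` Q `|` \bigcup_i A i) = set0 ->
  (forall i, A i `<=` closure W) -> False.
Proof.
move=> kA dA kP conP kQ conQ dPQ AP AQ conW dW AW.
have cP := compact_closed hplane kP; have cQ := compact_closed hplane kQ.
have cA i : closed (A i) by apply: compact_closed => //; case: (kA i).
have disj (B C : set plane) z : B `&` C = set0 -> B z -> ~ C z.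
  by move=> BC Bz Cz; have : (B `&` C) z by []; rewrite BC.
have [w Ww] : W !=set0.
  have [y [/AW Wy _]] := AP 0; have [z [Wz _]] := Wy setT filterT.
  by exists z.
have [x /choice[S /choice[T ST]]] := choice (fun i => continuum_crossing
  hplane (kA i).1 (kA i).2 cP cQ dPQ (AP i) (AQ i)).
have conS i : connected (S i) by have [[]] := ST i.
have conT i : connected (T i) by have [[]] := ST i.
have SA i z : S i z -> A i z by have [_ + _ _ _] := ST i; move=> /[apply] -[].
have SQ i z : S i z -> ~ Q z by have [_ + _ _ _] := ST i; move=> /[apply] -[].
have TA i z : T i z -> A i z by have [_ _ + _ _] := ST i; move=> /[apply] -[].
have TP i z : T i z -> ~ P z by have [_ _ + _ _] := ST i; move=> /[apply] -[].
have Sx i : S i (x i) by have [_ _ _ []] := ST i.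
have Tx i : T i (x i) by have [_ _ _ []] := ST i.
have /choice[a Ha] i : exists a, S i a /\ P a.
  by have [_ _ _ _ [[y [Sy Py]] _]] := ST i; exists y.
have /choice[b Hb] i : exists b, T i b /\ Q b.
  by have [_ _ _ _ [_ [y [Ty Qy]]]] := ST i; exists y.
have Aother i j z : i != j -> A i z -> ~ A j z.
  by move=> ij; apply: disj; exact: dA.
(* close to W, from x i to w *)
have /choice[f Hf] i : exists f : R -> plane, is_path f (x i) w /\
    forall t, ~ (P `|` Q `|` \bigcup_(j in [set j | i != j]) A j) (f t).
  have [|||||f pf Hf] := @avoid (P `|` Q `|` \bigcup_(j in [set j | i != j]) A j)
    (W `|` [set x i]) (x i) w.
  - by apply: closedU; [exact: closedU|exact: closed_others].
  - apply: (connected_sub_closure conW); first by move=> z; left.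
    by move=> z [/subset_closure//|->]; apply: (AW i); exact: SA.
  - move=> z [Wz|->].
      move=> H; apply: disj dW Wz _; case: H => [PQz|[j _ Aj]]; first by left.
      by right; exists j.
    move=> [[|]|[j ij]]; [exact: TP|exact: SQ|].
    by apply: Aother ij _; exact: SA.
  - by right.
  - by left.
  - by exists f.
have cf i : closed (range (f i)) by case: (Hf i) => /closed_range.
have fP i t : ~ P (f i t) by move=> ?; apply: ((Hf i).2 t); left; left.
have fQ i t : ~ Q (f i t) by move=> ?; apply: ((Hf i).2 t); left; right.
have fA i j t : i != j -> ~ A j (f i t).
  by move=> ij ?; apply: ((Hf i).2 t); right; exists j.
(* close to A i, first towards P and off Q, then towards Q and off P *)
have /choice[g Hg] i : exists g : R -> plane, is_path g (x i) (a i) /\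
    forall t, ~ (Q `|` \bigcup_(j in [set j | i != j]) (A j `|` range (f j))) (g t).
  have [|||//||g pg Hg] := @avoid
    (Q `|` \bigcup_(j in [set j | i != j]) (A j `|` range (f j)))
    (S i) (x i) (a i); last by exists g.
  - by apply: closedU => //; apply: closed_others => j; exact: closedU.
  - exact: conS.
  - move=> z Sz [Qz|[j ij [|[t _ ft]]]]; first exact: (SQ i z).
      by apply: Aother ij _; exact: SA.
    by apply: (@fA j i t); rewrite 1?eq_sym // ft; exact: SA.
  - by case: (Ha i).
have cg i : closed (range (g i)) by case: (Hg i) => /closed_range.
have gQ i t : ~ Q (g i t) by move=> ?; apply: ((Hg i).2 t); left.
have gA i j t : i != j -> ~ A j (g i t).
  by move=> ij ?; apply: ((Hg i).2 t); right; exists j => //; left.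
have gf i j t s : i != j -> g i t <> f j s.
  by move=> ij gf; apply: ((Hg i).2 t); right; exists j => //; right; exists s.
have /choice[h Hh] i : exists h : R -> plane, is_path h (x i) (b i) /\
    forall t, ~ (P `|` \bigcup_(j in [set j | i != j])
      (range (f j) `|` range (g j))) (h t).
  have [|||//||h ph Hh] := @avoid
    (P `|` \bigcup_(j in [set j | i != j]) (range (f j) `|` range (g j)))
    (T i) (x i) (b i); last by exists h.
  - by apply: closedU => //; apply: closed_others => j; exact: closedU.
  - exact: conT.
  - move=> z Tz [Pz|[j ij [|][t _ ft]]]; first exact: (TP i z).
      by apply: (@fA j i t); rewrite 1?eq_sym // ft; exact: TA.
    by apply: (@gA j i t); rewrite 1?eq_sym // ft; exact: TA.
  - by case: (Hb i).
have ch i : closed (range (h i)) by case: (Hh i) => /closed_range.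
have hP i t : ~ P (h i t) by move=> ?; apply: ((Hh i).2 t); left.
have hf i j t s : i != j -> h i t <> f j s.
  by move=> ij hf; apply: ((Hh i).2 t); right; exists j => //; left; exists s.
have hg i j t s : i != j -> h i t <> g j s.
  by move=> ij hg; apply: ((Hh i).2 t); right; exists j => //; right; exists s.
(* close to P and close to Q *)
have /choice[n Hn] i : exists n : R -> plane, is_path n (a i) (a 0) /\
    forall t, ~ (Q `|` \bigcup_(j in setT) (range (f j) `|` range (h j))) (n t).
  have [|||||n pn Hn] := @avoid
    (Q `|` \bigcup_(j in setT) (range (f j) `|` range (h j)))
    P (a i) (a 0); last by exists n.
  - by apply: closedU => //; apply: closed_others => j; exact: closedU.
  - exact: conP.
  - move=> z Pz [|[j ij [|][t _ ft]]]; first exact: disj dPQ Pz.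
      by apply: (@fP j t); rewrite ft.
    by apply: (@hP j t); rewrite ft.
  - by case: (Ha i).
  - by case: (Ha 0).
have cn i : closed (range (n i)) by case: (Hn i) => /closed_range.
have nQ i t : ~ Q (n i t) by move=> ?; apply: ((Hn i).2 t); left.
have nf i j t s : n i t <> f j s.
  by move=> nf; apply: ((Hn i).2 t); right; exists j => //; left; exists s.
have nh i j t s : n i t <> h j s.
  by move=> nh; apply: ((Hn i).2 t); right; exists j => //; right; exists s.
have /choice[m Hm] i : exists m : R -> plane, is_path m (b i) (b 0) /\
    forall t, ~ (\bigcup_(j in setT)
      (range (f j) `|` range (g j) `|` range (n j))) (m t).
  have [|||||m pm Hm] := @avoid
    (\bigcup_(j in setT) (range (f j) `|` range (g j) `|` range (n j)))
    Q (b i) (b 0); last by exists m.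
  - by apply: closed_others => j; do 2 apply: closedU => //.
  - exact: conQ.
  - move=> z Qz [j _ [[|]|][t _ ft]].
    + by apply: (@fQ j t); rewrite ft.
    + by apply: (@gQ j t); rewrite ft.
    + by apply: (@nQ j t); rewrite ft.
  - by case: (Hb i).
  - by case: (Hb 0).
have mf i j t s : m i t <> f j s.
  by move=> E; apply: ((Hm i).2 t); exists j => //; left; left; exists s.
have mg i j t s : m i t <> g j s.
  by move=> E; apply: ((Hm i).2 t); exists j => //; left; right; exists s.
have mn i j t s : m i t <> n j s.
  by move=> E; apply: ((Hm i).2 t); exists j => //; right; exists s.
pose leg i (v : 'I_3) : set plane := if v == 0 then range (g i) `|` range (n i)
  else if v == 1 then range (h i) `|` range (m i) else range (f i).
pose p (v : 'I_3) := if v == 0 then a 0 else if v == 1 then b 0 else w.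
have /choice[e He] (iv : 'I_3 * 'I_3) : exists e : R -> plane,
    is_path e (x iv.1) (p iv.2) /\ forall t, leg iv.1 iv.2 (e t).
  case: iv => i v; rewrite /leg /p /=.
  case: ifP => _; last case: ifP => _.
  - have [||e pe He] := @joined_trans _ _ (range (g i) `|` range (n i))
      (x i) (a i) (a 0); last by exists e.
      by exists (g i); [case: (Hg i)|move=> t; left; exists t].
    by exists (n i); [case: (Hn i)|move=> t; right; exists t].
  - have [||e pe He] := @joined_trans _ _ (range (h i) `|` range (m i))
      (x i) (b i) (b 0); last by exists e.
      by exists (h i); [case: (Hh i)|move=> t; left; exists t].
    by exists (m i); [case: (Hm i)|move=> t; right; exists t].
  - by exists (f i); split; [case: (Hf i)|move=> t; exists t].
apply: (@no_planar_K33 _ x p (fun i v => e (i, v))).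
  by move=> i v; case: (He (i, v)).
suff legs i j (v u : 'I_3) z : i != j -> (v < u)%N -> leg i v z -> ~ leg j u z.
  move=> i j v u ij vu s t est.
  have l1 := (He (i, v)).2 s; have l2 := (He (j, u)).2 t; rewrite /= in l1 l2.
  rewrite est in l1.
  case: (ltngtP v u) => [lt|lt|/val_inj E]; last by rewrite E eqxx in vu.
    exact: legs ij lt l1 l2.
  by apply: legs lt l2 l1; rewrite eq_sym.
move=> ij; have ji : j != i by rewrite eq_sym.
case: v u => [[|[|[|//]]] hv] [[|[|[|//]]] hu] //= _; rewrite /leg /=.
- move=> [[s _ <-]|[s _ <-]] [[t _]|[t _]].
  + exact: hg.
  + exact: mg.
  + by move/esym; exact: nh.
  + exact: mn.
- move=> [[s _ <-]|[s _ <-]] [t _ /esym]; [exact: gf|exact: nf].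
- move=> [[s _ <-]|[s _ <-]] [t _ /esym]; [exact: hf|exact: mf].
Qed.

End three_continua.

(** * Subspaces and diameters *)

Section subspaces.
Variable X : topologicalType.

Lemma connected_set_val (A G : set X) : connected G -> G `<=` A ->
  connected ((set_val : A -> X) @^-1` G).
Proof.
move=> cG GA B [b Bb] [C [C' oC' <-] BC] [D cD BD].
have [D' oD' DD'] := closed_openC cD.
have Dval (y : A) : D y <-> ~ D' (set_val y).
  split=> [Dy D'y|nD'].
    have : (~` D) y by rewrite -DD'.
    exact.
  by apply: contrapT => nD; have : (~` D) y by []; rewrite -DD'.
have E : G `&` C' = G.
  apply: cG.
  - by exists (set_val b); move: Bb; rewrite BC => -[].
  - by exists C'.
  - exists (~` D'); first exact: open_closedC.
    apply/seteqP; split=> y [Gy yC]; split=> //; have Ay := mem_set (GA _ Gy).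
      have : B (SigSub Ay) by rewrite BC.
      by rewrite BD => -[_ /Dval].
    have : B (SigSub Ay) by rewrite BD; split=> //; apply/Dval.
    by rewrite BC => -[].
by rewrite BC -preimage_setI E.
Qed.

Lemma compact_set_type (A : set X) : compact A -> compact [set: A].
Proof.
move=> kA F PF _; have FA : (set_val @ F) A.
  by apply: (@filterS _ F _ setT) => [x _|]; [exact: set_valP|exact: filterT].
have [p [Ap clp]] := kA _ _ FA.
exists (SigSub (mem_set Ap)); split=> // U V FU [_ [[V' oV' <-] /= V'p] V'V].
have FU' : (set_val @ F) (set_val @` U).
  by apply: (@filterS _ F _ U) => // x Ux; exists x.
have [_ [[x Ux <-] V'x]] := clp _ _ FU' (open_nbhs_nbhs (conj oV' V'p)).
by exists x; split=> //; exact: V'V.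
Qed.

End subspaces.

Section metric_facts.
Variables (R : realType) (M : metricType R).
Implicit Types (A B : set M) (x y z : M).

Lemma open_mdist_lt x (r : R) : open [set y | mdist x y < r].
Proof.
rewrite openE => y /= xy; apply/nbhs_ballP; exists (r - mdist x y) => /=.
  by rewrite subr_gt0.
move=> z; rewrite ballEmdist /= => yz.
by apply: le_lt_trans (metric_triangle x y z) _; rewrite -ltrBrDl.
Qed.

Lemma closed_mdist_le x (r : R) : closed [set y | mdist x y <= r].
Proof.
rewrite -openC openE => y /= /negP; rewrite -ltNge => xy.
apply/nbhs_ballP; exists (mdist x y - r) => /=; first by rewrite subr_gt0.
move=> z; rewrite ballEmdist /= => yz; apply/negP; rewrite -ltNge.
by have := metric_triangle x z y; rewrite (metric_sym z y); lra.
Qed.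

Lemma mdist_bounded : compact [set: M] ->
  exists b : R, forall x y : M, mdist x y <= b.
Proof.
move=> kM; have [[x0 _]|M0] := pselect ([set: M] !=set0); last first.
  by exists 0 => x; exfalso; apply: M0; exists x.
have := (compact_near_coveringP _).1 kM nat \oo (fun n x => mdist x0 x <= n%:R) _.
case=> [x _|n _ Hn].
  exists ([set y | mdist x y < 1], [set n | (Num.truncn (mdist x0 x + 1) < n)%N]).
    split; last by exists (Num.truncn (mdist x0 x + 1)).+1.
    by apply: open_nbhs_nbhs; split; [exact: open_mdist_lt|rewrite /= mdistxx].
  move=> [y n] [/= xy xn]; apply: le_trans (metric_triangle x0 x y) _.
  apply: (@le_trans _ _ (mdist x0 x + 1)); first by rewrite lerD2l ltW.
  apply/ltW/(lt_le_trans (truncnS_gt _)).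
  by rewrite ler_nat.
exists (n%:R + n%:R) => x y; apply: le_trans (metric_triangle x x0 y) _.
by apply: lerD; [rewrite metric_sym|]; exact: (Hn n (leqnn n)).
Qed.

Lemma mdist_le_diam A x y : compact [set: M] -> A x -> A y ->
  mdist x y <= diam A.
Proof.
move=> kM Ax Ay; have [b Hb] := mdist_bounded kM.
apply: ub_le_sup; first by exists b => _ [u _ [v _ <-]].
by exists x => //; exists y.
Qed.

Lemma diam_lt_ex A (c : R) : A !=set0 -> c < diam A ->
  exists x y, [/\ A x, A y & c < mdist x y].
Proof.
move=> [a Aa] cA; apply: contrapT => nxy.
suff : diam A <= c by rewrite leNgt cA.
apply: ge_sup; first by exists (mdist a a), a => //; exists a.
move=> _ [x Ax [y Ay <-]]; rewrite leNgt; apply/negP => cxy.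
by apply: nxy; exists x, y.
Qed.

Lemma diam_subset A B : compact [set: M] -> A !=set0 -> A `<=` B ->
  diam A <= diam B.
Proof.
move=> kM [a Aa] AB; apply: ge_sup; first by exists (mdist a a), a => //; exists a.
by move=> _ [x Ax [y Ay <-]]; apply: mdist_le_diam => //; exact: AB.
Qed.

Lemma component_subcontinuum B x : compact B -> B x ->
  subcontinuum (connected_component B x).
Proof.
move=> kB Bx; have cB := compact_closed (@metric_hausdorff R M) kB.
split; [|apply: (subclosed_compact _ kB)|exact: component_connected].
- by exists x; exact: connected_component_refl.
- exact: component_closed.
- exact: connected_component_sub.
Qed.

Lemma components_disjoint B x y z : connected_component B x z ->
  connected_component B y z -> connected_component B x = connected_component B y.
Proof.
move=> xz yz; apply: same_connected_component.
exact: connected_component_trans xz (connected_component_sym yz).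
Qed.

End metric_facts.

(** * Finitely Suslinian compacta are Peano compacta *)

Section suslinian_peano.
Variables (R : realType) (M : metricType R).
Hypothesis FS : finitely_suslinian M.

Let kM : compact [set: M] := FS.1.
Let hM : hausdorff_space M := @metric_hausdorff R M.

(** The components of the closed ball of A that come within r / 2 of p without
containing p extend to distance r from p (there are none when A lies in the open
ball). So there are finitely many of them, and their union is a closed set that
does not contain p. *)
Lemma suslinian_im_kleinen (A : set M) (p : M) (r : R) : compact A ->
  connected A -> A p -> 0 < r -> exists2 d : R, 0 < d &
  A `&` [set y | mdist p y < d] `<=`
  connected_component (A `&` [set y | mdist p y <= r]) p.
Proof.
move=> kA conA Ap r0; set B := A `&` _; set C := connected_component B.
have cA := compact_closed hM kA.
have kB : compact B.
  apply: subclosed_compact kA _; last by move=> y [].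
  by apply: closedI => //; exact: closed_mdist_le.
pose F := [set C y | y in [set y | [/\ A y, mdist p y < r / 2 & ~ C p y]]].
have inB y : A y -> mdist p y < r / 2 -> B y.
  by move=> Ay py; split=> //=; lra.
have finF : finite_set F.
  apply: FS.2.
  - by move=> _ [y [Ay py _] <-]; apply: component_subcontinuum => //; exact: inB.
  - by move=> _ _ [y _ <-] [z _ <-] [t [yt zt]]; exact: components_disjoint yt zt.
  - exists (r / 2); first by lra.
    move=> _ [y [Ay py nCy] <-].
    have [z Cz pz] : exists2 z, C y z & r <= mdist p z.
      apply: contrapT => nz.
      have CU : C y `<=` [set z | mdist p z < r].
        move=> z Cz /=; rewrite ltNge; apply/negP => rz.
        by apply: nz; exists z.
      apply: (@component_leaves_open R M hM A B [set z | mdist p z < r] y) => //.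
      + by move=> z [Az /ltW].
      + by move=> z [].
      + exact: open_mdist_lt.
      + by rewrite /=; lra.
      + move=> AU; apply: nCy.
        have AB : A `<=` B by move=> z Az; split=> //; exact/ltW/AU.
        exact: (connected_component_max Ap AB conA).
    have yz : mdist y z <= diam (C y).
      by apply: mdist_le_diam => //; apply: connected_component_refl; exact: inB.
    by have := metric_triangle p y z; lra.
have cF : closed (\bigcup_(D in F) D).
  apply: closed_bigcup => // _ [y _ <-].
  by apply: component_closed; exact: compact_closed.
have nF : ~ (\bigcup_(D in F) D) p.
  by move=> [_ [y [Ay py nCy] <-]] /connected_component_sym.
have /nbhs_ballP[d /= d0 dF] :=
  open_nbhs_nbhs (conj (closed_openC cF) nF : open_nbhs p (~` \bigcup_(D in F) D)).
exists (Num.min d (r / 2)); first by rewrite lt_min d0 /=; lra.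
move=> y [Ay]; rewrite /= lt_min => /andP[yd yr]; apply: contrapT => nCy.
have : ball p d y by rewrite ballEmdist.
move/dF; apply; exists (C y); first by exists y.
by apply: connected_component_refl; exact: inB.
Qed.

(** By [suslinian_im_kleinen] at each of its points, a component of an open subset of
A is open in A. *)
Lemma suslinian_locally_connected (A : set M) : compact A -> connected A ->
  locally_connected (set_type A).
Proof.
move=> kA conA x U [U' oU' <-] U'x.
pose G := connected_component (A `&` U') (set_val x).
have GAU : G `<=` A `&` U' by exact: connected_component_sub.
have Gx : G (set_val x).
  by apply: connected_component_refl; split => //; exact: set_valP.
have nG y : G y -> nbhs y (G `|` ~` A).
  move=> Gy; have [Ay U'y] := GAU _ Gy.
  have /nbhs_ballP[r /= r0 rU] := open_nbhs_nbhs (conj oU' U'y).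
  have [|d d0 Hd] := @suslinian_im_kleinen A y (r / 2) kA conA Ay.
    by lra.
  apply/nbhs_ballP; exists d => //= z; rewrite ballEmdist /= => yz.
  have [Az|] := pselect (A z); last by right.
  left; rewrite /G (same_connected_component Gy).
  have [D [Dy DB cD] Dz] := Hd z (conj Az yz); exists D => //; split=> // t Dt.
  have [At yt] := DB _ Dt; split=> //; apply: rU; rewrite ballEmdist /=.
  by move: yt => /=; lra.
exists (set_val @^-1` G); split=> //.
- exists (interior (G `|` ~` A)); first exact: open_interior.
  apply/seteqP; split=> y; last by move=> Gy; exact: nG.
  by move=> /interior_subset [//|nA]; case: nA; exact: set_valP.
- apply: connected_set_val; first exact: component_connected.
  by move=> y /GAU [].
- by move=> y /GAU [].
Qed.

Lemma suslinian_peano : peano_compactum M.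
Proof.
have sub A : components M A -> subcontinuum A.
  by move=> [x _ <-]; exact: component_subcontinuum.
split=> //.
- move=> A cA; have [A0 kA conA] := sub A cA; split=> //.
  exact: suslinian_locally_connected.
- move=> C C0; apply: FS.2; last first.
  + by exists C => // A [_ /negP]; rewrite -leNgt.
  + by move=> _ _ [[x _ <-] _] [[y _ <-] _] [z [xz yz]]; exact: components_disjoint xz yz.
  + by move=> A [/sub].
Qed.

End suslinian_peano.

(** * Coordinates of the complex plane *)

Section coordinates.
Variable R : realType.

Lemma normc_ge_Im (z : R[i]) : `|complex.Im z|%:C <= `|z|.
Proof.
case: z => x y /=; rewrite normc_def lecR -sqrtr_sqr.
by rewrite ler_sqrt ?addr_ge0 ?sqr_ge0 // lerDr sqr_ge0.
Qed.

Let lipschitz_continuous (g : {additive R[i] -> R}) :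
  (forall z, `|g z|%:C <= `|z|) -> continuous (g : R[i]^o -> R).
Proof.
move=> gle z A /nbhs_ballP[e /= e0 eA]; apply/nbhs_ballP.
exists e%:C => /=; first by rewrite ltcR.
move=> y zy; apply: eA; move: zy; rewrite -!ball_normE /ball_ /= => zy.
by rewrite -raddfB -ltcR; apply: le_lt_trans (gle _) zy.
Qed.

Lemma continuous_Re : continuous (@complex.Re R : R[i]^o -> R).
Proof. exact: (@lipschitz_continuous (@complex.Re R) (@normc_ge_Re R)). Qed.

Lemma continuous_Im : continuous (@complex.Im R : R[i]^o -> R).
Proof. exact: (@lipschitz_continuous (@complex.Im R) normc_ge_Im). Qed.

Definition coords (z : R[i]^o) : R * R := (complex.Re z, complex.Im z).

Lemma continuous_coords : continuous coords.
Proof. exact: (continuous_pair continuous_Re continuous_Im). Qed.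

Lemma coords_inj : injective coords.
Proof. by move=> [x y] [x' y'] [-> ->]. Qed.

End coordinates.

(** * Blocks of a decomposition *)

Section decompositions.
Variable X : topologicalType.
Implicit Types D : decomposition X.

Lemma blockE D (d : set X) (x : X) : blocks D d -> d x ->
  d = [set y | \pi_(quotient_space D) y = \pi_(quotient_space D) x].
Proof.
move=> Dd dx; case: (blocksP D) => _ tD _.
have same (e : set X) z : blocks D e -> e z -> set_val (\pi_(quotient_space D) z) = e.
  move=> De ez; apply: tD => //; first exact: (set_valP (\pi_(quotient_space D) z)).
  by exists z; split=> //; exact: mem_pi.
apply/seteqP; split=> [y dy|y /= yx].
  by apply: val_inj; rewrite -set_valE (same d y) // (same d x).
by rewrite -(same d x Dd dx) -yx; exact: mem_pi.
Qed.

Lemma fibre_block D (d : quotient_space D) :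
  [set y | \pi_(quotient_space D) y = d] = set_val d.
Proof.
have [x dx] := ex_repr d; have dD : blocks D (set_val d) by exact: set_valP.
rewrite (blockE dD dx); apply/seteqP.
suff -> : \pi_(quotient_space D) x = d by split=> y /=.
apply: val_inj; case: (blocksP D) => _ tD _.
apply: tD => //; first exact: set_valP.
by exists x; split=> //; exact: mem_pi.
Qed.

Lemma finer_antisym D D' : finer D D' -> finer D' D -> blocks D = blocks D'.
Proof.
suff sub (E E' : decomposition X) : finer E E' -> finer E' E -> blocks E `<=` blocks E'.
  by move=> DD' D'D; apply/seteqP; split; exact: sub.
move=> [g gE] [h hE] e Ee; have [x ex] : e !=set0.
  by case: (blocksP E) => _ _; exact.
have -> : e = set_val (\pi_(quotient_space E') x).
  rewrite -fibre_block (blockE Ee ex); apply/seteqP; split=> y /= yx.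
    by rewrite gE /= yx.
  by rewrite hE /= yx.
exact: set_valP.
Qed.

End decompositions.

(** * Monotone maps *)

Section monotone_maps.
Variables (R : realType) (X : topologicalType) (M : metricType R) (phi : X -> M).
Hypotheses (kX : compact [set: X]) (cphi : continuous phi).
Hypothesis phi_surj : forall m, exists x, phi x = m.
Hypothesis fibre_conn : forall m, connected [set x | phi x = m].

Let hM : hausdorff_space M := @metric_hausdorff R M.

Let closed_compact (C : set X) : closed C -> compact C.
Proof. by move=> cC; apply: subclosed_compact kX _. Qed.

Let image_closed (C : set X) : closed C -> closed (phi @` C).
Proof.
move=> cC; apply: compact_closed => //; apply: continuous_compact.
  exact: continuous_subspaceT.
exact: closed_compact.
Qed.

Let preimage_closed (C : set M) : closed C -> closed (phi @^-1` C).
Proof. by move=> cC; apply: (@preimage_closed _ _ phi). Qed.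

(** Each fibre lies on one side of a separation of the preimage, so the separation
comes from one of C; the images are closed because X is compact. *)
Lemma monotone_preimage_connected (C : set M) : closed C -> connected C ->
  connected (phi @^-1` C).
Proof.
move=> cC conC; apply/connectedP => E [E0 CE sepE].
have cE b : closed (E b).
  by apply: separated_closed sepE _ b; rewrite -CE; exact: preimage_closed.
have Edisj x y : E false x -> E true y -> phi x <> phi y.
  move=> Ex Ey xy.
  have [|sub|sub] := connected_subset sepE _ (@fibre_conn (phi x)).
  - by rewrite -CE => z /= ->; have : (phi @^-1` C) x by rewrite CE; left.
  - have := separated_disjoint sepE; rewrite -subset0; apply.
    by split; [exact: (sub y)|exact: Ey].
  - have := separated_disjoint sepE; rewrite -subset0; apply.
    by split; [exact: Ex|exact: (sub x)].
move: conC => /connectedP /(_ (fun b => phi @` E b)); apply; split.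
- by move=> b; have [x Ex] := E0 b; exists (phi x), x.
- apply/seteqP; split=> [m Cm|m].
    have [x xm] := phi_surj m; have : (phi @^-1` C) x by rewrite /= xm.
    by rewrite CE => -[Ex|Ex]; [left|right]; exists x.
  have EC b x : E b x -> C (phi x).
    by move=> Ex; suff : (phi @^-1` C) x by []; rewrite CE; case: b Ex; [right|left].
  by move=> [|] [x /EC Cx <-].
- have d : phi @` E false `&` phi @` E true = set0.
    by rewrite -subset0 => _ [[x Ex <-] [y Ey /esym]]; exact: Edisj.
  by rewrite /separated -!(closure_id _).1 //; exact: image_closed.
Qed.

Lemma monotone_preimage_subcontinuum (C : set M) : subcontinuum C ->
  subcontinuum (phi @^-1` C).
Proof.
move=> [[m Cm] kC conC]; have cC := compact_closed hM kC; split.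
- by have [x xm] := phi_surj m; exists x; rewrite /= xm.
- by apply: closed_compact; exact: preimage_closed.
- exact: monotone_preimage_connected.
Qed.

End monotone_maps.

(** * Monotone quotients of planar compacta *)

Section peano_nbhs.
Variables (R : realType) (M : metricType R).
Let hM : hausdorff_space M := @metric_hausdorff R M.

Lemma peano_continuum_nbhs (P : set M) (a : M) (r : R) :
  peano_continuum P -> P a -> 0 < r ->
  exists N : set M, [/\ subcontinuum N, N `<=` [set y | mdist a y <= r] &
    exists2 d : R, 0 < d & P `&` [set y | mdist a y < d] `<=` N].
Proof.
move=> [[P0 kP conP] lcP] Pa r0; have cP := compact_closed hM kP.
pose a' : P := SigSub (mem_set Pa).
have [||V [[V' oV' VE] Va conV VU]] :=
    lcP a' (set_val @^-1` [set y | mdist a y < r]).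
- by exists [set y | mdist a y < r] => //; exact: open_mdist_lt.
- by rewrite /= mdistxx.
have V'a : V' a by move: Va; rewrite -VE.
have VP : set_val @` V `<=` P by move=> _ [y _ <-]; exact: set_valP.
have conN : connected (set_val @` V).
  apply: connected_continuous_connected => //.
  by apply: continuous_subspaceT; exact: initial_continuous.
exists (closure (set_val @` V)); split.
- split; last exact: connected_closure.
    by exists a; apply: subset_closure; exists a'.
  apply: subclosed_compact kP _; first exact: closed_closure.
  by move=> z /(closureS VP); rewrite -(closure_id P).1.
- rewrite [X in _ `<=` X](closure_id _).1; last exact: closed_mdist_le.
  by apply: closureS => _ [y Vy <-]; exact: (ltW (VU y Vy)).
- have /nbhs_ballP[d /= d0 dV] := open_nbhs_nbhs (conj oV' V'a).
  exists d => // y [Py ay]; apply: subset_closure.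
  exists (SigSub (mem_set Py)) => //; rewrite -VE /=.
  by apply: dV; rewrite ballEmdist.
Qed.

End peano_nbhs.

Section planar_quotients.
Variables (R : realType) (X : topologicalType) (M : metricType R).
Variables (phi : X -> M) (psi : X -> R * R) (W : set (R * R)).
Hypotheses (kX : compact [set: X]) (cphi : continuous phi).
Hypothesis phi_surj : forall m, exists x, phi x = m.
Hypothesis fibre_conn : forall m, connected [set x | phi x = m].
Hypotheses (cpsi : continuous psi) (psi_inj : injective psi).
Hypotheses (conW : connected W) (psiW : forall x, ~ W (psi x)).
Hypothesis psi_closure : forall x, closure W (psi x).

Let lift (C : set M) := psi @` (phi @^-1` C).

Let lift_subcontinuum C : subcontinuum C -> compact (lift C) /\ connected (lift C).
Proof.
move=> /(monotone_preimage_subcontinuum kX cphi phi_surj fibre_conn) [_ kC conC].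
have wpsi : {within phi @^-1` C, continuous psi} by exact: continuous_subspaceT.
by split; [exact: continuous_compact|exact: connected_continuous_connected].
Qed.

Let lift_disjoint C D : C `&` D = set0 -> lift C `&` lift D = set0.
Proof.
move=> CD; rewrite -subset0 => _ [[x Cx <-] [y Dy /psi_inj yx]].
suff : (C `&` D) (phi x) by rewrite CD.
by split=> //; rewrite -yx.
Qed.

Let lift_meets C D : C `&` D !=set0 -> lift C `&` lift D !=set0.
Proof.
move=> [m [Cm Dm]]; have [x xm] := phi_surj m.
by exists (psi x); split; exists x => //; rewrite /= xm.
Qed.

(** In an infinite family of disjoint large continua in M, three would join small
disjoint connected neighbourhoods of two distinct points. The preimages in X
contradict [no_three_continua]. *)
Lemma peano_planar_suslinian : peano_compactum M -> finitely_suslinian M.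
Proof.
move=> [kM peanoM finM]; split=> // F contF disjF [C C0 diamF].
apply: contrapT => infF.
pose big := [set P | components M P /\ ~ (diam P < C)].
(* infinitely many members lie in the same component of M *)
have [P [bigP infP]] : exists P, big P /\ infinite_set [set A | F A /\ A `<=` P].
  apply: contrapT => fin; apply: infF.
  apply: (@sub_finite_set _ _ (\bigcup_(P in big) [set A | F A /\ A `<=` P])).
    move=> A FA; have [[a Aa] _ conA] := contF A FA.
    exists (connected_component [set: M] a).
      split; first by exists a.
      apply/negP; rewrite -leNgt; apply: le_trans (diamF A FA) _.
      apply: diam_subset => //; first by exists a.
      exact: connected_component_max.
    by split=> //; exact: connected_component_max.
  apply: bigcup_finite; first exact: finM.
  by move=> P bigP; apply: contrapT => infP; apply: fin; exists P.
have peanoP : peano_continuum P by apply: peanoM; case: bigP.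
have [[_ kP _] _] := peanoP.
have /infiniteP/pcard_leP/unsquash A := infP.
have FA n : F (A n) by have [] := @funS _ _ _ _ A n I.
have AP n : A n `<=` P by have [] := @funS _ _ _ _ A n I.
have A_inj n n' : n != n' -> A n `&` A n' = set0.
  move=> nn'; apply/eqP/negPn/negP => /set0P Ann'; move/eqP: nn'; apply.
  have := disjF _ _ (FA n) (FA n') Ann'.
  by move=> /(@inj _ _ _ A); apply; rewrite inE.
have /choice[a /choice[b ab]] n : exists a b, [/\ A n a, A n b & C / 2 < mdist a b].
  apply: diam_lt_ex; first by case: (contF _ (FA n)).
  by apply: lt_le_trans (diamF _ (FA n)); lra.
have [[p q] [[Pp Pq] clpq]] :
    (P `*` P) `&` cluster ((fun n => (a n, b n)) @ \oo) !=set0.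
  apply: (compact_setX kP kP).
  exists 0 => // n _; have [Aa Ab _] := ab n.
  by split; [exact: (AP n _ Aa)|exact: (AP n _ Ab)].
have often (d : R) (N : nat) : 0 < d ->
    exists n, [/\ (N <= n)%N, mdist p (a n) < d & mdist q (b n) < d].
  move=> d0.
  have [] := clpq [set z | exists2 n, (N <= n)%N & z = (a n, b n)]
      ([set y | mdist p y < d] `*` [set y | mdist q y < d]).
  - by exists N => // n Nn; exists n.
  - exists ([set y | mdist p y < d], [set y | mdist q y < d]) => //.
    by split; apply: open_nbhs_nbhs; split; rewrite /= ?mdistxx //;
      exact: open_mdist_lt.
  - by move=> _ [[n Nn ->] [pa qb]]; exists n.
have pq : C / 4 < mdist p q.
  have [|n [_ pa qb]] := often (C / 8) 0%N; first by lra.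
  have [_ _ hab] := ab n; have := metric_triangle (a n) p (b n).
  have := metric_triangle p q (b n); rewrite (metric_sym (a n) p); lra.
have [|Np [contNp Npr [dp dp0 Hdp]]] := peano_continuum_nbhs (r := C / 16) peanoP Pp.
  by lra.
have [|Nq [contNq Nqr [dq dq0 Hdq]]] := peano_continuum_nbhs (r := C / 16) peanoP Pq.
  by lra.
have Npq : Np `&` Nq = set0.
  rewrite -subset0 => z [/Npr /= pz /Nqr /= qz].
  by have := metric_triangle p z q; rewrite (metric_sym z q); lra.
have meet N : exists n, [/\ (N <= n)%N, A n `&` Np !=set0 & A n `&` Nq !=set0].
  have [|n [Nn pa qb]] := often (Num.min dp dq) N; first by rewrite lt_min dp0.
  have [Aa Ab _] := ab n.
  move: pa qb; rewrite !lt_min => /andP[pa _] /andP[_ qb].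
  exists n; split=> //; [exists (a n)|exists (b n)]; split=> //.
    by apply: Hdp; split=> //; exact: AP Aa.
  by apply: Hdq; split=> //; exact: AP Ab.
have [n0 [_ n0p n0q]] := meet 0%N.
have [n1 [n01 n1p n1q]] := meet n0.+1.
have [n2 [n12 n2p n2q]] := meet n1.+1.
pose k (i : 'I_3) := if i == 0 then n0 else if i == 1 then n1 else n2.
have k_inj i j : i != j -> k i != k j.
  have n02 := ltn_trans n01 n12.
  case: i j => [[|[|[|//]]] hi] [[|[|[|//]]] hj] //= _; rewrite /k /=.
  - by rewrite ltn_eqF.
  - by rewrite ltn_eqF.
  - by rewrite gtn_eqF.
  - by rewrite ltn_eqF.
  - by rewrite gtn_eqF.
  - by rewrite gtn_eqF.
have [kNp conNp] := lift_subcontinuum contNp.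
have [kNq conNq] := lift_subcontinuum contNq.
apply: (@no_three_continua R (fun i => lift (A (k i))) (lift Np) (lift Nq) W) => //.
- by move=> i; apply: lift_subcontinuum; apply: contF.
- by move=> i j /k_inj /A_inj; exact: lift_disjoint.
- exact: lift_disjoint.
- by move=> i; apply: lift_meets; rewrite /k; case: ifP => // _; case: ifP.
- by move=> i; apply: lift_meets; rewrite /k; case: ifP => // _; case: ifP.
- rewrite -subset0 => z [Wz zK].
  suff [x xz] : exists x, psi x = z by apply: (@psiW x); rewrite xz.
  by case: zK => [[|]|[i _]] [x _ xz]; exists x.
- by move=> i _ [x _ <-]; exact: psi_closure.
Qed.

End planar_quotients.

(** * Unshielded compacta *)

Lemma unshielded_suslinian (R : realType) (K : set R[i]^o)
    (D : decomposition (set_type K)) :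
  compact K -> unshielded K -> monotone_decomposition D ->
  quotient_has D (@peano_compactum R) -> quotient_has D (@finitely_suslinian R).
Proof.
move=> kK uK [_ contD] [M [[f [g [cf cg fg gf]]] peanoM]]; exists M.
split; first by exists f, g.
have [W [[z _ WE] _ KE]] := uK.
have KW y : K y -> closure W y by rewrite {1}KE => -[].
pose phi (x : set_type K) : M := f (\pi_(quotient_space D) x).
pose psi (x : set_type K) := coords (set_val x).
have cval : continuous (set_val : set_type K -> R[i]^o) by exact: initial_continuous.
apply: (@peano_planar_suslinian R (set_type K) M phi psi (@coords R @` W)) => //.
- exact: compact_set_type.
- exact: (continuous_compose (@pi_continuous _ (quotient_space D)) cf).
- move=> m; have [x xm] := ex_repr (g m).
  exists (block_repr (g m)).
  by rewrite /phi quotient_piE block_reprK gf.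
- move=> m.
  have -> : [set x | phi x = m] = set_val (g m).
    rewrite -fibre_block; apply/seteqP; split=> x /=; rewrite /phi.
      by move=> <-; rewrite fg.
    by move=> ->; rewrite gf.
  by have [_ _] := contD _ (set_valP (g m)).
- exact: (continuous_compose cval (@continuous_coords R)).
- by move=> x y /coords_inj; exact: val_inj.
- apply: connected_continuous_connected; first by rewrite WE; exact: component_connected.
  exact: continuous_subspaceT (@continuous_coords R).
- move=> x [w Ww /coords_inj wx]; move: Ww; rewrite WE wx.
  by move=> /connected_component_sub; apply; exact: set_valP.
- move=> x V /(continuous_coords (x := set_val x)) Vx.
  have [w [Ww Vw]] := KW _ (set_valP x) _ Vx.
  by exists (coords w); split=> //; exists w.
Qed.

Theorem mainTheorem10 (R : realType) (K : set R[i]^o)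
    (K_compact : compact K) (K_unshielded : unshielded K)
    (D_PC D_FS : decomposition (set_type K))
    (core_PC : core_decomposition (@peano_compactum R) D_PC)
    (core_FS : core_decomposition (@finitely_suslinian R) D_FS) :
  blocks D_PC = blocks D_FS.
Proof.
have [monPC PC minPC] := core_PC; have [monFS FS minFS] := core_FS.
apply: finer_antisym.
  apply: minPC => //; have [M [hM FSM]] := FS; exists M; split=> //.
  exact: suslinian_peano.
by apply: minFS => //; exact: unshielded_suslinian.
Qed.
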